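(* Let $\mathcal U=[0,1]$, $\mu=\lambda$ the Lebesgue measure on $[0,1]$, $u_i^N=\frac iN$, and let $K:[0,1]\times[0,1]\to\mathbb R$ and $f:\Sigma\times\Sigma\to\mathbb R$ satisfy assumptions (a) and (b) (stated in the context). For each $N$ let $K^N$ be a real function defined on $\{(\frac iN,\frac jN):i,j=1,\dots,N\}$, and assume that $\|K^N-K\|_\square\to0$ as $N\to\infty$. For $\boldsymbol x\in\Sigma^N$ and $1\le i\le N$ set $$F_N\Big(x_i,m^{N,i}_{\boldsymbol x},\tfrac iN\Big)=\frac1{N-1}\sum_{j\ne i}K^N\Big(\frac iN,\frac jN\Big)f(x_i,x_j),\qquad F(x,m,u)=\int_{[0,1]\times\Sigma}K(u,v)f(x,y)\,m(dv,dy).$$ Then $$\lim_{N\to+\infty}\ \sup_{\boldsymbol x\in\Sigma^N}\ \frac1N\sum_{i=1}^N\Big|F_N\Big(x_i,m^{N,i}_{\boldsymbol x},\tfrac iN\Big)-F\Big(x_i,m^{N,i}_{\boldsymbol x},\tfrac iN\Big)\Big|=0 .$$ (The same holds for a second pair $G_N,G$ of the same form.)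
   Context: $\Sigma=\{1,\dots,d\}$ is a finite set. For $\boldsymbol x\in\Sigma^N$, $m^{N,i}_{\boldsymbol x}=\frac1{N-1}\sum_{j\neq i}\delta_{(j/N,\,x_j)}$, a probability measure on $[0,1]\times\Sigma$. Assumption (a): $f:\Sigma\times\Sigma\to\mathbb R$ and $K:[0,1]\times[0,1]\to\mathbb R$ are bounded (Borel measurable) functions. Assumption (b): for every $\epsilon>0$ there exists an open set $A_\epsilon\subseteq[0,1]\times[0,1]$ such that $K$ is uniformly continuous on $A_\epsilon$ and, denoting $B^u_\epsilon=\{v:(u,v)\in A_\epsilon\}$, one has $\lambda\big((B^u_\epsilon)^c\big)\le\epsilon$ for every $u\in[0,1]$. $K^N$ is extended to $[0,1)^2$ as the step function $K^N(u,v):=K^N\Big(\frac{\lfloor Nu+1\rfloor}N,\frac{\lfloor Nv+1\rfloor}N\Big)$. The cut norm is $$\|K^N-K\|_\square:=\sup_{S,T\in\mathcal B([0,1])}\Big|\int_{S\times T}[K^N(u,v)-K(u,v)]\,du\,dv\Big| ,$$ where $\mathcal B([0,1])$ is the Borel $\sigma$-field. *)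

(* Defs.v *)
From HB Require Import structures.
From mathcomp Require Import all_boot all_order all_algebra.
From mathcomp Require Import all_classical all_reals all_analysis.

Set Implicit Arguments.
Unset Strict Implicit.
Unset Printing Implicit Defensive.

Import Order.TTheory GRing.Theory Num.Theory.
Import numFieldNormedType.Exports.

Local Open Scope classical_set_scope.
Local Open Scope ring_scope.

(* The finite set Sigma is encoded as ['I_d.+1] (hence nonempty, with d + 1
   elements) and carries the discrete sigma-algebra. *)
HB.instance Definition _ (d : nat) := isPointed.Build 'I_d.+1 ord0.

HB.instance Definition _ (d : nat) :=
  @isMeasurable.Build default_measure_display 'I_d.+1 discrete_measurable
    (@discrete_measurable0 _) (@discrete_measurableC _)
    (@discrete_measurableU _).

Section kernels.
Context {R : realType}.
Implicit Types (A : set (R * R)) (K W : R * R -> R).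

Definition unit_square : set (R * R) := `[0, 1] `*` `[0, 1].

Definition bounded_Borel K : Prop :=
  [bounded K z | z in unit_square] /\ measurable_fun unit_square K.

(* [A] is open relatively to the unit square: a subset of the unit square that
   is open in the plane would have empty sections at [u = 0] and [u = 1]. *)
Definition almost_uniformly_continuous K : Prop :=
  forall e : R, 0 < e ->
    exists A, [/\ A `<=` unit_square,
                  exists2 O : set (R * R), open O & A = O `&` unit_square,
                  unif_continuous (K : subspace A -> R) &
                  forall u : R, u \in `[0, 1] ->
                    (lebesgue_measure (`[0%R, 1%R]%classic `\` xsection A u) <= e%:E)%E].

Definition cut_norm W : \bar R :=
  ereal_sup [set `|\int[lebesgue_measure \x lebesgue_measure]_(z in ST.1 `*` ST.2)
                    (W z)%:E|%E
            | ST in [set ST : set R * set R |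
                [/\ measurable ST.1, ST.1 `<=` `[0, 1],
                    measurable ST.2 & ST.2 `<=` `[0, 1]]]].

(* Only the values of [KN] at the points [(i/N, j/N)], [1 <= i, j <= N], are
   used on [0, 1)^2; the function is set to 0 elsewhere. *)
Definition step_extension (N : nat) (KN : R * R -> R) : R * R -> R :=
  (fun z => KN ((Num.floor (N%:R * z.1 + 1))%:~R / N%:R,
                (Num.floor (N%:R * z.2 + 1))%:~R / N%:R))
  \_ (`[0, 1[ `*` `[0, 1[).

(* The index [i : 'I_N] stands for [i + 1] in {1, ..., N}. *)
Definition grid (N : nat) (i : 'I_N) : R := i.+1%:R / N%:R.

End kernels.

Section empirical_measure.
Context {R : realType} {d N : nat} (x : {ffun 'I_N -> 'I_d.+1}) (i : 'I_N).

Definition empirical_measure (S : set (R * 'I_d.+1)) : \bar R :=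
  ((N.-1%:R^-1)%:E * \sum_(j < N | j != i) \d_((grid j, x j)) S)%E.

Let empirical_measure0 : empirical_measure set0 = 0%E.
Proof. by rewrite /empirical_measure big1 ?mule0// => j _; rewrite measure0. Qed.

Let empirical_measure_ge0 S : (0 <= empirical_measure S)%E.
Proof.
by apply: mule_ge0; [rewrite lee_fin invr_ge0|exact: sume_ge0].
Qed.

Let empirical_measure_sigma_additive : semi_sigma_additive empirical_measure.
Proof.
move=> F mF tF mUF.
have c0 : 0 <= N.-1%:R^-1 :> R by rewrite invr_ge0.
pose c : {nonneg R} := NngNum c0.
pose m (k : nat) : {measure set (R * 'I_d.+1) -> \bar R} :=
  if insub k is Some j then
    if j != i then [the measure _ _ of \d_((grid j, x j))]
    else [the measure _ _ of mzero]
  else [the measure _ _ of mzero].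
have E S : empirical_measure S = mscale c (msum m N) S.
  rewrite /empirical_measure /mscale /msum; congr (_ * _)%E.
  rewrite big_mkcond; apply: eq_bigr => j _.
  by rewrite /m valK; case: ifP.
rewrite E; under eq_fun do under eq_bigr do rewrite E.
exact: (@measure_semi_sigma_additive _ _ _ (mscale c (msum m N))).
Qed.

HB.instance Definition _ := isMeasure.Build _ _ _ empirical_measure
  empirical_measure0 empirical_measure_ge0 empirical_measure_sigma_additive.

End empirical_measure.

Section interactions.
Context {R : realType} {d : nat}.

Definition interaction (K : R * R -> R) (f : 'I_d.+1 * 'I_d.+1 -> R)
    (a : 'I_d.+1) (m : {measure set (R * 'I_d.+1) -> \bar R}) (u : R) : R :=
  \int[m]_(z in `[0, 1] `*` setT) (K (u, z.1) * f (a, z.2)).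

(* Sum form of [interaction KN f (x i) (empirical_measure x i) (grid i)], which
   only evaluates [KN] on the grid. *)
Definition finite_interaction (N : nat) (KN : R * R -> R)
    (f : 'I_d.+1 * 'I_d.+1 -> R) (x : {ffun 'I_N -> 'I_d.+1}) (i : 'I_N) : R :=
  N.-1%:R^-1 * \sum_(j < N | j != i) KN (grid i, grid j) * f (x i, x j).

End interactions.

(* Main.v *)
Require Import Defs.
From mathcomp Require Import all_boot all_order all_algebra.
From mathcomp Require Import all_classical all_reals all_analysis.
From mathcomp Require Import measurable_realfun lra ring.
Import Order.TTheory GRing.Theory Num.Theory.
Import numFieldNormedType.Exports.
Local Open Scope classical_set_scope.
Local Open Scope ring_scope.

(** Put [w i j := (K^N(i/N, j/N) - K(i/N, j/N)) / N^2].  Integrating against the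
    empirical measure turns [F] into the same sum as [F_N] with [K] in place of
    [K^N], so the quantity to bound is
    [N / (N - 1) * sum_i |sum_(j != i) w i j f(x_i, x_j)|].

    Two facts make it small uniformly in [x].

    First, such a sum is controlled by the largest rectangle sum
    [c := max_(P, P') |sum_(i in P, j in P') w i j|].  Grouping the [j] by the
    value of [x_j] leaves, for each of the finitely many values, an expression
    [sum_i |sum_(j in Q) w i j|], which is at most [2c] by separating the [i]
    according to the sign of the inner sum ([sum_norm_rows_le]).  This bounds the
    full sums over [j]; dropping [j = i] costs the trace norm
    [sum_i |w i i|].  As [K^N] may be large on the diagonal, this too must come
    from the rectangle sums, and it is at most [4c] ([sum_norm_diag_le]): for
    suitable signs [t], a quadratic form [sum_(i, j) t_i t_j a i j] is at least its
    trace ([exists_signs]); with [a i j] the product of [w i j] and the sign of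
    [w i i], the trace is the trace norm of [w] and the form is a signed
    combination of four rectangle sums.

    Second, [c] tends to 0.  A rectangle sum of [w] is the integral of
    [step K^N - step K] over a union of cells, where [step] denotes the step
    extension from the grid, hence at most the cut norm of [step K^N - K] plus
    the [L^1] norm of [step K - K] ([grid_sum_le_cut_norm]).  The former tends to
    0 by assumption.  For the latter, almost every point [z] of the square lies
    in one of the sets on which [K] is uniformly continuous; these are open in
    the square, so they contain the grid points used by the step extension
    near [z], and [step K z] converges to [K z].  As [K] is bounded, dominated
    convergence applies ([step_error_cvg]). *)

(** * Matrices whose rectangle sums are small *)

(** The average of the quadratic form over independent uniform signs is its
    trace, so some choice of signs reaches the trace.  The signs are found
    greedily: each new index takes the sign that makes its cross terms with the
    previous indices nonnegative. *)
Lemma exists_signs (R : realDomainType) (N : nat) (a : 'I_N -> 'I_N -> R) :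
  exists t : 'I_N -> bool,
    \sum_i a i i <= \sum_i \sum_j (-1) ^+ t i * (-1) ^+ t j * a i j.
Proof.
elim: (index_enum _) (index_enum_uniq 'I_N) => [_|k s IH /= /andP[ks us]].
  by exists (fun=> false); rewrite !big_nil.
have [t ht] := IH us.
(* The cross terms of [k] with [s], up to the sign of [k]. *)
pose S := \sum_(j <- s) (-1) ^+ t j * (a k j + a j k).
pose t' i := if i == k then (S < 0)%R else t i.
have t's i : i \in s -> t' i = t i.
  by move=> si; rewrite /t'; case: eqP => // ik; move: ks; rewrite -ik si.
exists t'; rewrite !big_cons.
have -> : \sum_(i <- s) \sum_(j <- k :: s) (-1) ^+ t' i * (-1) ^+ t' j * a i j =
   (-1) ^+ (S < 0)%R * (\sum_(j <- s) (-1) ^+ t j * a j k) +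
   \sum_(i <- s) \sum_(j <- s) (-1) ^+ t i * (-1) ^+ t j * a i j.
  under eq_bigr do rewrite big_cons.
  rewrite big_split /= mulr_sumr; congr (_ + _).
    by apply: eq_big_seq => i si; rewrite (t's _ si) {1}/t' eqxx; ring.
  by apply: eq_big_seq => i si; apply: eq_big_seq => j sj; rewrite !t's.
have -> : \sum_(j <- s) (-1) ^+ t' k * (-1) ^+ t' j * a k j =
   (-1) ^+ (S < 0)%R * (\sum_(j <- s) (-1) ^+ t j * a k j).
  by rewrite mulr_sumr; apply: eq_big_seq => i si; rewrite (t's _ si) {1}/t' eqxx; ring.
have -> : (-1) ^+ t' k * (-1) ^+ t' k * a k k = a k k.
  by rewrite -expr2 sqrr_sign mul1r.
have hS : 0 <= (-1) ^+ (S < 0)%R * S by rewrite -normrEsign.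
have SE : S = \sum_(j <- s) (-1) ^+ t j * a k j + \sum_(j <- s) (-1) ^+ t j * a j k.
  by rewrite -big_split; apply: eq_bigr => j _; rewrite mulrDr.
move: hS; rewrite [X in _ * X]SE mulrDr => hS.
by rewrite -addrA lerD2l addrA; apply: le_trans ht _; rewrite lerDr.
Qed.

Section cut_bounded.
Context (R : realDomainType) (N : nat) (w : 'I_N -> 'I_N -> R) (c : R).
Hypothesis wc : forall P Q : {set 'I_N},
  `|\sum_(i in P) \sum_(j in Q) w i j| <= c.

(** Separating the rows by sign gives two rectangle sums. *)
Lemma sum_signed_rows_le (s : 'I_N -> bool) (Q : {set 'I_N}) :
  \sum_i (-1) ^+ s i * \sum_(j in Q) w i j <= c *+ 2.
Proof.
pose P : {set 'I_N} := [set i | s i]%SET.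
rewrite (bigID (mem P)) /=.
rewrite mulr2n lerD//.
  apply: le_trans (wc P Q); rewrite -normrN; apply: le_trans (ler_norm _).
  rewrite -sumrN ler_sum// => i; rewrite inE => ->; by rewrite expr1 mulN1r.
apply: le_trans (wc (~: P) Q); apply: le_trans (ler_norm _).
rewrite [leLHS](eq_bigl (fun i => i \in ~: P)); last by move=> i; rewrite !inE.
by rewrite ler_sum// => i; rewrite !inE => /negbTE ->; rewrite expr0 mul1r.
Qed.

Lemma sum_norm_rows_le (Q : {set 'I_N}) :
  \sum_i `|\sum_(j in Q) w i j| <= c *+ 2.
Proof.
under eq_bigr do rewrite normrEsign.
exact: sum_signed_rows_le.
Qed.

(** Separating the columns by sign as well gives four rectangle sums. *)
Lemma signed_form_le (s t : 'I_N -> bool) :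
  \sum_i \sum_j (-1) ^+ s i * (-1) ^+ t j * w i j <= c *+ 4.
Proof.
pose P : {set 'I_N} := [set i | t i]%SET.
have -> : \sum_i \sum_j (-1) ^+ s i * (-1) ^+ t j * w i j =
    \sum_i (-1) ^+ s i * (\sum_(j in ~: P) w i j) +
    \sum_i (-1) ^+ (~~ s i) * (\sum_(j in P) w i j).
  rewrite -big_split; apply: eq_bigr => i _ /=.
  rewrite (bigID (mem P)) /= addrC !mulr_sumr; congr (_ + _).
    apply: eq_big => [j|j]; first by rewrite !inE.
    by rewrite !inE => /negbTE ->; rewrite expr0 mulr1.
  apply: eq_bigr => j; rewrite !inE => ->.
  by rewrite expr1 signrN mulrN1.
by rewrite (mulrnDr c 2 2) lerD// sum_signed_rows_le.
Qed.

(** Applying [exists_signs] to the matrix whose rows carry the signs of the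
    diagonal entries of [w] reduces the trace norm to a signed form. *)
Lemma sum_norm_diag_le : \sum_i `|w i i| <= c *+ 4.
Proof.
have [t ht] := exists_signs R N (fun i j => (-1) ^+ (w i i < 0)%R * w i j).
under eq_bigr do rewrite normrEsign.
apply: le_trans ht _.
apply: le_trans (signed_form_le (fun i => t i (+) (w i i < 0)) t).
rewrite le_eqVlt; apply/orP; left; apply/eqP.
by apply: eq_bigr => i _; apply: eq_bigr => j _; rewrite signr_addb; ring.
Qed.

(** The full row sums are treated by grouping the columns by colour [x j], on
    which [f (x i) (x j)] depends only on [i]; the diagonal is then removed at the
    cost of its trace norm. *)
Lemma sum_norm_offdiag_le (T : finType) (x : 'I_N -> T) (f : T -> T -> R) (M : R) :
  0 <= M -> (forall a b, `|f a b| <= M) ->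
  \sum_i `|\sum_(j | j != i) w i j * f (x i) (x j)| <= M * c *+ (2 * #|T| + 4).
Proof.
move=> M0 fM.
have rows : \sum_i `|\sum_j w i j * f (x i) (x j)| <= M * c *+ (2 * #|T|).
  apply: (@le_trans _ _ (\sum_i \sum_b M * `|\sum_(j in [set j | x j == b]%SET) w i j|)).
    apply: ler_sum => i _.
    rewrite (partition_big x xpredT) //=.
    apply: le_trans (ler_norm_sum _ _ _) _; apply: ler_sum => b _.
    rewrite (_ : \sum_(j | x j == b) _ =
        f (x i) b * \sum_(j in [set j | x j == b]%SET) w i j).
      by rewrite normrM ler_wpM2r.
    rewrite mulr_sumr; apply: eq_big => [j|j /eqP ->]; first by rewrite !inE.
    by rewrite mulrC.
  rewrite exchange_big /=.
  apply: (@le_trans _ _ (\sum_(b : T) M * c *+ 2)); last first.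
    by rewrite sumr_const -mulrnA lexx.
  apply: ler_sum => b _; rewrite -mulr_sumr -mulrnAr.
  by rewrite ler_wpM2l// sum_norm_rows_le.
have diag : \sum_i `|w i i * f (x i) (x i)| <= M * c *+ 4.
  apply: (@le_trans _ _ (M * \sum_i `|w i i|)).
    rewrite mulr_sumr; apply: ler_sum => i _.
    by rewrite normrM mulrC ler_wpM2r.
  by rewrite -mulrnAr ler_wpM2l// sum_norm_diag_le.
rewrite mulrnDr; apply: le_trans (lerD rows diag).
rewrite -big_split /=; apply: ler_sum => i _.
rewrite [X in _ <= `|X| + _](bigD1 i)//= -[leLHS]normrN.
move: (w i i * _) (\sum_(j | _) _) => u v.
have -> : - v = u - (u + v) by rewrite opprD addrA subrr sub0r.
by rewrite [leRHS]addrC; exact: ler_normB.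
Qed.

End cut_bounded.

(** * Cells of the grid and step functions *)

Definition half_open_square (R : realType) : set (R * R) := `[0, 1[ `*` `[0, 1[.
Arguments half_open_square R : clear implicits.

(** The cell on which the step extension takes its value from [grid i], which is
    the right endpoint; the cells are half-open so that they partition [0, 1). *)
Definition cell {R : realType} {N : nat} (i : 'I_N) : set R :=
  `[i%:R / N%:R, grid i[.

Definition block {R : realType} {N : nat} (P : {set 'I_N}) : set R :=
  \bigcup_(i in [set` P]) cell i.

Section cells.
Context {R : realType} {N : nat}.
Implicit Types (i j : 'I_N) (P : {set 'I_N}).
Local Notation mu := (@lebesgue_measure R).

Lemma ord_gt0 i : (0 < N)%N. Proof. exact: leq_ltn_trans (ltn_ord i). Qed.

Lemma cellP i (t : R) : cell i t <-> i%:R <= N%:R * t < i%:R + 1.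
Proof.
have N0 : 0 < N%:R :> R by rewrite ltr0n (ord_gt0 i).
by rewrite /cell /grid /= in_itv/= ler_pdivrMr// ltr_pdivlMr// mulrC natr1.
Qed.

Lemma floor_cell i (t : R) :
  cell i t -> (Num.floor (N%:R * t + 1))%:~R / N%:R = grid i :> R.
Proof.
move=> /cellP /andP[it ti]; rewrite (@floor_def _ _ (i.+1%:Z)) //.
by rewrite -[i.+1]addn1 !intrD /= -!pmulrn; lra.
Qed.

Lemma cell_uniq i j (t : R) : cell i t -> cell j t -> i = j.
Proof.
move=> /cellP /andP[it ti] /cellP /andP[jt tj]; apply/val_inj/eqP.
rewrite eqn_leq; apply/andP; split; rewrite -ltnS -(ltr_nat R) -natr1.
  exact: le_lt_trans it tj.
exact: le_lt_trans jt ti.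
Qed.

Lemma cell_sub i : cell i `<=` (`[0, 1[ : set R).
Proof.
move=> t /cellP /andP[it ti].
have N0 : 0 < N%:R :> R by rewrite ltr0n (ord_gt0 i).
have iN : i%:R + 1 <= N%:R :> R by rewrite natr1 ler_nat.
rewrite /= in_itv/=; apply/andP; split.
  by rewrite -(pmulr_rge0 _ N0) (le_trans _ it).
by rewrite -(ltr_pM2l N0) mulr1 (lt_le_trans ti).
Qed.

Lemma cell_cover (t : R) : (0 < N)%N -> `[0, 1[%classic t -> exists i, cell i t.
Proof.
move=> N0; rewrite /= in_itv/= => /andP[t0 t1].
have N0' : 0 < N%:R :> R by rewrite ltr0n.
have Nt0 : 0 <= N%:R * t by rewrite mulr_ge0.
have lt : (Num.truncn (N%:R * t) < N)%N.
  rewrite -(ltr_nat R); apply: (@le_lt_trans _ _ (N%:R * t)); first by rewrite truncn_le.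
  by rewrite -[ltRHS]mulr1 ltr_pM2l.
by exists (Ordinal lt); apply/cellP; rewrite natr1 /= truncn_itv.
Qed.

Lemma grid_itv i : `[0%R, 1%R]%classic (grid i : R).
Proof.
have N0 : 0 < N%:R :> R by rewrite ltr0n (ord_gt0 i).
by rewrite /= in_itv/= divr_ge0//= ler_pdivrMr// mul1r ler_nat.
Qed.

Lemma measurable_cell i : measurable (cell i : set R).
Proof. exact: measurable_itv. Qed.

Lemma lebesgue_measure_cell i : mu (cell i) = (N%:R^-1)%:E.
Proof.
have N0 : 0 < N%:R :> R by rewrite ltr0n (ord_gt0 i).
rewrite /cell lebesgue_measure_itv /= lte_fin /grid ltr_pM2r ?invr_gt0//.
by rewrite ltr_nat ltnSn -EFinB -mulrBl -natr1 addrC addKr mul1r.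
Qed.

Lemma measurable_block P : measurable (block P : set R).
Proof.
by apply: fin_bigcup_measurable => // i _; exact: measurable_cell.
Qed.

Lemma block_sub P : block P `<=` (`[0, 1[ : set R).
Proof. by apply: bigcup_sub => i _; exact: cell_sub. Qed.

(** The indexed union has the form expected by additivity of the integral. *)
Lemma block_setX P P' : block P `*` block P' =
  \big[setU/set0]_(ij <- enum (finset.setX P P'))
    (cell ij.1 `*` cell ij.2 : set (R * R)).
Proof.
rewrite -bigcup_seq; apply/seteqP; split=> [[u v] [[i iP iu] [j jP jv]]|].
  exists (i, j) => //=; by rewrite mem_enum finset.in_setX iP jP.
move=> [u v] [[i j] /=]; rewrite mem_enum finset.in_setX => /andP[iP jP] [iu jv].
by split; [exists i|exists j].
Qed.

Lemma step_extension_cell (G : R * R -> R) i j (z : R * R) :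
  cell i z.1 -> cell j z.2 -> step_extension N G z = G (grid i, grid j).
Proof.
move=> iz jz; rewrite /step_extension patchE mem_set.
  by rewrite (floor_cell _ _ iz) (floor_cell _ _ jz).
by split; [exact: cell_sub iz|exact: cell_sub jz].
Qed.

End cells.

Section step_functions.
Context {R : realType}.
Local Notation mu := (@lebesgue_measure R).
Local Notation mu2 := (product_measure1 mu mu).
Implicit Types (G : R * R -> R).

Lemma measurable_half_open_square : measurable (half_open_square R).
Proof. by apply: measurableX; exact: measurable_itv. Qed.

Lemma half_open_square_lty : (mu2 (half_open_square R) < +oo)%E.
Proof.
rewrite /half_open_square product_measure1E; do ?exact: measurable_itv.
by rewrite /= !lebesgue_measure_itv /= lte01 -EFinB -EFinM ltry.
Qed.

(** Whatever the values on the grid, a preimage is a finite union of products of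
    cells. *)
Lemma measurable_step_extension N G :
  (0 < N)%N -> measurable_fun (half_open_square R) (step_extension N G).
Proof.
move=> N0 _ B mB.
pose D := [set ij : 'I_N * 'I_N | B (G (grid ij.1, grid ij.2))].
rewrite (_ : _ `&` _ = \bigcup_(ij in D) (cell ij.1 `*` cell ij.2)).
  apply: fin_bigcup_measurable => // ij _.
  by apply: measurableX; exact: measurable_cell.
apply/seteqP; split=> [[u v] [[/= u01 v01]]|[u v] [[i j] DB [/= ui vj]]].
  have [i ui] := cell_cover _ N0 u01; have [j vj] := cell_cover _ N0 v01.
  by rewrite (step_extension_cell G i j) => // DB; exists (i, j).
split; first by split; [exact: cell_sub ui|exact: cell_sub vj].
by rewrite /= (step_extension_cell G i j).
Qed.

Lemma step_extension_bounded N G : (0 < N)%N ->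
  [bounded step_extension N G z | z in half_open_square R].
Proof.
move=> N0.
exists (\sum_i \sum_j `|G (grid (i : 'I_N), grid (j : 'I_N))|).
split; first exact: num_real.
move=> M GM [u v] [/= u01 v01]; apply: le_trans (ltW GM).
have [i ui] := cell_cover _ N0 u01; have [j vj] := cell_cover _ N0 v01.
rewrite (step_extension_cell G i j)// (bigD1 i)//= (bigD1 j)//= -addrA lerDl.
by rewrite addr_ge0// sumr_ge0// => *; rewrite sumr_ge0.
Qed.

Lemma integrable_step_extension N G : (0 < N)%N ->
  mu2.-integrable (half_open_square R) (EFin \o step_extension N G).
Proof.
move=> N0; apply: measurable_bounded_integrable.
- exact: measurable_half_open_square.
- exact: half_open_square_lty.
- exact: measurable_step_extension.
- exact: step_extension_bounded.
Qed.

Lemma block_setX_sub {N} (P P' : {set 'I_N}) :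
  block P `*` block P' `<=` half_open_square R.
Proof. by move=> [u v] [/= /block_sub ? /block_sub ?]. Qed.

Lemma integral_step_extension N G (P P' : {set 'I_N}) : (0 < N)%N ->
  (\int[mu2]_(z in block P `*` block P') (step_extension N G z)%:E =
   (\sum_(i in P) \sum_(j in P') G (grid i, grid j) / (N%:R ^+ 2))%:E)%E.
Proof.
move=> N0; rewrite block_setX integral_bigsetU_EFin; first last.
- rewrite -block_setX; apply/measurable_EFinP.
  apply: measurable_funS (measurable_step_extension N G N0).
    exact: measurable_half_open_square.
  exact: block_setX_sub.
- move=> [i j] [i' j'] _ _ [[u v] [[/= ui vj] [/= ui' vj']]].
  by rewrite (cell_uniq i i' u) // (cell_uniq j j' v).
- exact: enum_uniq.
- by move=> ij; apply: measurableX; exact: measurable_cell.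
rewrite pair_big/= -sumEFin big_enum/=; apply: eq_big => [[i j]|[i j] _] /=.
  by rewrite finset.in_setX.
rewrite (eq_integral (cst (G (grid i, grid j))%:E)).
  rewrite integral_cst; last by apply: measurableX; exact: measurable_cell.
  rewrite [X in (_ * X)%E]product_measure1E; do ?exact: measurable_cell.
  by rewrite /= !lebesgue_measure_cell -!EFinM expr2 invfM.
by move=> z /set_mem[iz jz]; rewrite (step_extension_cell G i j).
Qed.

End step_functions.

(** * Step functions of an almost uniformly continuous kernel *)

Section ae_continuity.
Context {R : realType}.
Local Notation mu := (@lebesgue_measure R).
Local Notation mu2 := (product_measure1 mu mu).
Implicit Types (K : R * R -> R) (A O : set (R * R)).

(** The plane carries the product sigma-algebra, for which an open set is
    measurable because it is a countable union of products of balls with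
    rational centres and radii. *)
Lemma open_plane_measurable O : open O -> measurable O.
Proof.
move=> oO.
pose rball (c : rat * rat) : set R := ball (ratr c.1 : R) (ratr c.2).
pose F (p : (rat * rat) * (rat * rat)) : set (R * R) :=
  if `[< rball p.1 `*` rball p.2 `<=` O >] then rball p.1 `*` rball p.2 else set0.
suff -> : O = \bigcup_p F p.
  apply: countable_bigcupT_measurable => // p.
  rewrite /F; case: asboolP => // _.
  by apply: measurableX; exact: measurable_ball.
apply/seteqP; split=> [[u v] Ouv|z [p _]]; last first.
  by rewrite /F; case: asboolP => // pO /pO.
have /nbhs_ballP[e /= e0 eO] : nbhs (u, v) O by exact: open_nbhs_nbhs.
have rat_ball (t : R) : exists c, rball c t /\ rball c `<=` ball t e.
  have [|c1 [c2 [tc cS]]] := @open_subball_rat R (ball t e) t (ball_open t e).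
    exact/mem_set/ballxx.
  by exists (c1, c2); split=> //; exact/set_mem.
have [p [up pe]] := rat_ball u; have [q [vq qe]] := rat_ball v.
exists (p, q) => //; rewrite /F /=; case: asboolP => //= -[] [x y] [/= px qy].
by apply: eO; split; [exact: pe|exact: qe].
Qed.

(** The step extension is evaluated within [1/N] of its argument. *)
Lemma cell_endpoint_cvg (t : R) :
  (Num.floor (n.+1%:R * t + 1))%:~R / n.+1%:R @[n --> \oo] --> t.
Proof.
apply: (@squeeze_cvgr _ _ _ _ (cst t) (fun n => t + harmonic n)).
- near=> n; have /andP[lb ub] := floor_itv (n.+1%:R * t + 1).
  have n0 : 0 < n.+1%:R :> R by rewrite ltr0n.
  rewrite /= ler_pdivlMr// ler_pdivrMr// mulrDl /harmonic /= mulVf ?gt_eqF//.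
  rewrite ![t * _]mulrC lb andbT.
  by move: ub; rewrite intrD ltrD2r => /ltW.
- exact: cvg_cst.
- rewrite -[X in _ --> X]addr0; apply: cvgD; [exact: cvg_cst|exact: cvg_harmonic].
Unshelve. all: by end_near. Qed.

(** Being relatively open, [A] eventually contains the grid points at which the
    step extension is evaluated; continuity of [K] along [A] is then enough. *)
Lemma step_extension_cvg K A O (z : R * R) :
  open O -> A = O `&` unit_square -> unif_continuous (K : subspace A -> R) ->
  A z -> half_open_square R z ->
  step_extension n.+1 K z @[n --> \oo] --> K z.
Proof.
move=> oO AO Kc Az Qz.
pose g n : R * R := ((Num.floor (n.+1%:R * z.1 + 1))%:~R / n.+1%:R,
                     (Num.floor (n.+1%:R * z.2 + 1))%:~R / n.+1%:R).
have gz : g @ \oo --> z.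
  by rewrite [z]surjective_pairing;
    exact: (cvg_pair (cell_endpoint_cvg z.1) (cell_endpoint_cvg z.2)).
have gsq n : unit_square (g n).
  have [/= /(cell_cover _ (ltn0Sn n))[i iu] /(cell_cover _ (ltn0Sn n))[j jv]] := Qz.
  by rewrite /g (floor_cell _ _ iu) (floor_cell _ _ jv); split; exact: grid_itv.
have gA : \forall n \near \oo, A (g n).
  have Oz : nbhs z O by apply: open_nbhs_nbhs; split=> //; move: Az; rewrite AO => -[].
  by near=> n; rewrite AO; split; [near: n; exact: gz|exact: gsq].
have -> : (fun n => step_extension n.+1 K z) = K \o g.
  by apply/funext => n; rewrite /step_extension patchE mem_set.
apply/cvgrPdist_lt => e e0.
have [V eV VK] := Kc _ (entourage_ball R (PosNum e0)).
have zV : nbhs z (xsection V z) by exact: nbhs_entourage.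
near=> n.
apply: (VK (z, g n)); right; split=> //=; split; first by near: n.
by apply/xsectionP; near: n; exact: gz.
Unshelve. all: by end_near. Qed.

(** The points of the square outside all the sets given by the hypothesis for
    [e = 1/(k+1)] form a null set by Tonelli, as each vertical section is null;
    elsewhere [step_extension_cvg] applies. *)
Lemma ae_step_extension_cvg K : almost_uniformly_continuous K ->
  {ae mu2, forall z, half_open_square R z ->
    (step_extension n.+1 K z)%:E @[n --> \oo] --> (K z)%:E}.
Proof.
move=> hK.
have /choice [A hA] : forall k : nat, exists A, [/\ A `<=` unit_square,
    exists2 O : set (R * R), open O & A = O `&` unit_square,
    unif_continuous (K : subspace A -> R) &
    forall u : R, u \in `[0, 1] ->
      (mu (`[0%R, 1%R]%classic `\` xsection A u) <= (k.+1%:R^-1)%:E)%E].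
  by move=> k; apply: hK; rewrite invr_gt0.
pose N := half_open_square R `\` \bigcup_k A k.
have mA k : measurable (A k).
  have [_ [U oU AU] _ _] := hA k; rewrite AU; apply: measurableI.
    exact: open_plane_measurable.
  by apply: measurableX; exact: measurable_itv.
have mN : measurable N.
  apply: measurableD; first exact: measurable_half_open_square.
  exact: bigcupT_measurable.
have N0 : mu2 N = 0%E.
  apply: integral0_eq => u _ /=.
  have mNu : measurable (xsection N u) by exact: measurable_xsection.
  have [u01|u01] := boolP (u \in `[0, 1]); last first.
    rewrite (_ : xsection N u = set0) ?measure0//; apply/seteqP; split=> // v.
    move=> /xsectionP[[/= + _] _]; rewrite in_itv/= => /andP[u0 u1].
    by move: u01; rewrite in_itv/= u0 (ltW u1).
  apply/eqP; rewrite eq_le measure_ge0 andbT; apply/lee_addgt0Pr => e e0.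
  rewrite add0e; have [k ke] : exists k, k.+1%:R^-1 < e.
    have [k ke] := ltr_add_invr e0.
    by exists k; rewrite add0r in ke.
  have [_ _ _ /(_ u u01) le] := hA k.
  have mAu : measurable (xsection (A k) u) by exact: measurable_xsection.
  apply: le_trans (le_trans le _); last by rewrite lee_fin ltW.
  apply: le_measure; rewrite ?inE//.
    apply: measurableD; first exact: measurable_itv.
    exact: mAu.
  move=> v /xsectionP[[_ /= v01] nA]; split.
    by move: v01; rewrite /= !in_itv/= => /andP[-> /ltW].
  by move=> /xsectionP Ak; apply: nA; exists k.
exists N; split=> // z /= /not_implyP[Qz ncvg]; split=> // -[k _ Akz].
apply: ncvg; apply/cvg_EFin; first exact: nearW.
have [_ [U oU AU] Kc _] := hA k.
exact: (step_extension_cvg K (A k) U).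
Qed.

Lemma half_open_square_sub : half_open_square R `<=` unit_square.
Proof.
by move=> [u v] [/=]; rewrite !in_itv/= => /andP[u0 /ltW u1] /andP[v0 /ltW v1];
  split; rewrite /= in_itv/= ?u0 ?v0.
Qed.

Lemma bounded_Borel_bound K : bounded_Borel K ->
  exists2 M, 0 <= M & forall z, unit_square z -> `|K z| <= M.
Proof.
move=> [[M [_ hM]] _]; exists (`|M| + 1); first by rewrite addr_ge0.
by apply: hM; rewrite (le_lt_trans (ler_norm M))// ltrDl.
Qed.

Lemma integrable_kernel K : bounded_Borel K ->
  mu2.-integrable (half_open_square R) (EFin \o K).
Proof.
move=> hK; have [M _ KM] := bounded_Borel_bound _ hK.
apply: measurable_bounded_integrable.
- exact: measurable_half_open_square.
- exact: half_open_square_lty.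
- apply: measurable_funS half_open_square_sub hK.2.
  by apply: measurableX; exact: measurable_itv.
- exists M; split; first exact: num_real.
  by move=> e Me z Qz; apply: le_trans (ltW Me); exact/KM/half_open_square_sub.
Qed.

Definition step_error K (N : nat) : \bar R :=
  \int[mu2]_(z in half_open_square R) `|(step_extension N K z)%:E - (K z)%:E|%E.

Lemma step_error_cvg K : bounded_Borel K -> almost_uniformly_continuous K ->
  step_error K N @[N --> \oo] --> 0%E.
Proof.
move=> hK Kc; have [M M0 KM] := bounded_Borel_bound _ hK.
rewrite -cvg_shiftS.
have iM : mu2.-integrable (half_open_square R) (cst M%:E).
  apply: measurable_bounded_integrable => //.
  - exact: measurable_half_open_square.
  - exact: half_open_square_lty.
  - by exists M; split; [exact: num_real|move=> e Me z _; rewrite ger0_norm// ltW].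
have stepM : {ae mu2, forall z n, half_open_square R z ->
    (`|(step_extension n.+1 K z)%:E| <= (cst M%:E) z)%E}.
  apply: aeW => z n [/= /(cell_cover _ (ltn0Sn n))[i iu]].
  move=> /(cell_cover _ (ltn0Sn n))[j jv].
  rewrite lee_fin (step_extension_cell _ _ _ _ iu jv).
  by apply: KM; split; exact: grid_itv.
by have [] := @dominated_convergence _ _ _ mu2 _ measurable_half_open_square
  (fun n z => (step_extension n.+1 K z)%:E) (EFin \o K) (cst M%:E)
  (fun n => measurable_int _ (integrable_step_extension n.+1 K (ltn0Sn n)))
  (measurable_int _ (integrable_kernel _ hK)) (ae_step_extension_cvg _ Kc) iM stepM.
Qed.

End ae_continuity.

(** * Integration against the empirical measure *)

Section empirical_integral.
Context {R : realType} {d N : nat}.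
Implicit Types (x : {ffun 'I_N -> 'I_d.+1}) (i : 'I_N).
Implicit Types (K : R * R -> R) (f : 'I_d.+1 * 'I_d.+1 -> R).

Lemma ge0_integral_empirical x i (D : set (R * 'I_d.+1))
    (g : R * 'I_d.+1 -> \bar R) :
  measurable D -> measurable_fun D g -> (forall z, D z -> (0 <= g z)%E) ->
  (forall j, D (grid j, x j)) ->
  (\int[empirical_measure x i]_(z in D) g z =
   (N.-1%:R^-1)%:E * \sum_(j < N | j != i) g (grid j, x j))%E.
Proof.
move=> mD mg g0 Dx.
have c0 : 0 <= N.-1%:R^-1 :> R by rewrite invr_ge0.
pose c : {nonneg R} := NngNum c0.
(* The sum over [j != i] as a sum over all indices, where [i] gets the zero
   measure. *)
pose m (k : nat) : {measure set (R * 'I_d.+1) -> \bar R} :=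
  if insub k is Some j then
    if j != i then [the measure _ _ of \d_((grid j, x j))]
    else [the measure _ _ of mzero]
  else [the measure _ _ of mzero].
rewrite (eq_measure_integral (mscale c (msum m N))); last first.
  move=> S _ _; rewrite /= /empirical_measure /mscale /msum; congr (_ * _)%E.
  by rewrite big_mkcond; apply: eq_bigr => j _; rewrite /m valK; case: ifP.
rewrite ge0_integral_mscale//; congr (_ * _)%E.
rewrite ge0_integral_measure_sum// [RHS]big_mkcond; apply: eq_bigr => j _.
rewrite /m valK; case: ifP => _; last by rewrite integral_measure_zero.
by rewrite integral_dirac// diracE mem_set// mul1e.
Qed.

(** The signed case follows by splitting [h] into its positive and negative
    parts, since both integrals are finite sums. *)
Lemma Rintegral_empirical x i (D : set (R * 'I_d.+1)) (h : R * 'I_d.+1 -> R) :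
  measurable D -> measurable_fun D h -> (forall j, D (grid j, x j)) ->
  \int[empirical_measure x i]_(z in D) h z =
  N.-1%:R^-1 * \sum_(j < N | j != i) h (grid j, x j).
Proof.
move=> mD mh Dx.
have mEh : measurable_fun D (EFin \o h) by exact/measurable_EFinP.
rewrite /Rintegral integralE.
rewrite !ge0_integral_empirical//; do ?[exact: measurable_funepos|exact: measurable_funeneg].
rewrite (eq_bigr (fun j => (Num.max (h (grid j, x j)) 0)%:E)); last first.
  by move=> j _; rewrite funeposE /= EFin_max.
rewrite [X in (_ - _ * X)%E](eq_bigr
  (fun j => (Num.max (- h (grid j, x j)) 0)%:E)); last first.
  by move=> j _; rewrite funenegE /= EFin_max.
rewrite !sumEFin -!EFinM -EFinB /= -mulrBr -sumrB; congr (_ * _).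
apply: eq_bigr => j _.
case: (leP 0 (h (grid j, x j))) => h0.
  by rewrite [X in _ - X]max_r ?subr0// oppr_le0.
by rewrite sub0r max_l ?opprK// oppr_ge0 ltW.
Qed.

Lemma interaction_empirical K f x i : bounded_Borel K ->
  interaction K f (x i) (empirical_measure x i) (grid i) =
  finite_interaction K f x i.
Proof.
move=> [_ mK].
have mD : measurable (`[0%R, 1%R]%classic `*` [set: 'I_d.+1] : set (R * 'I_d.+1)).
  by apply: measurableX => //; exact: measurable_itv.
apply: Rintegral_empirical => //; last by move=> j; split=> //; exact: grid_itv.
apply: measurable_funM.
  apply: (@measurable_comp _ _ _ _ _ _ unit_square K _
    (fun z : R * 'I_d.+1 => (grid i, z.1)) _ _ mK).
  - by apply: measurableX; exact: measurable_itv.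
  - by move=> _ [[t a] [/= t01 _] <-]; split; [exact: grid_itv|].
  - apply: measurable_funTS; apply: measurable_fun_pair; first exact: measurable_cst.
    exact: measurable_fst.
apply: measurable_funTS.
apply: (@measurableT_comp _ _ _ _ _ _ (fun a => f (x i, a)) _ snd) => //.
Qed.

End empirical_integral.

(** * The cut norm controls the interaction error *)

Section approximation.
Context {R : realType}.
Local Notation mu := (@lebesgue_measure R).
Local Notation mu2 := (product_measure1 mu mu).
Implicit Types (G K : R * R -> R).

(** The sum is the integral of the difference of the two step extensions over a
    product of blocks; the kernel [K] itself is inserted between them. *)
Lemma grid_sum_le_cut_norm N G K (P P' : {set 'I_N}) :
  (0 < N)%N -> bounded_Borel K ->
  (`|\sum_(i in P) \sum_(j in P')
       (G (grid i, grid j) - K (grid i, grid j)) / N%:R ^+ 2|%:E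
   <= cut_norm (step_extension N G \- K)%R + step_error K N)%E.
Proof.
move=> N0 hK.
pose B : set (R * R) := block P `*` block P'.
have mB : measurable B by apply: measurableX; exact: measurable_block.
have BQ : B `<=` half_open_square R by exact: block_setX_sub.
have iB h : mu2.-integrable (half_open_square R) (EFin \o h) ->
    mu2.-integrable B (EFin \o h).
  by apply: integrableS => //; exact: measurable_half_open_square.
have iK := iB _ (integrable_kernel _ hK).
have iG H := iB _ (integrable_step_extension N H N0).
have subE H : (\int[mu2]_(z in B) ((step_extension N H z)%:E - (K z)%:E) =
    (\sum_(i in P) \sum_(j in P') H (grid i, grid j) / N%:R ^+ 2)%:E
    - \int[mu2]_(z in B) (K z)%:E)%E.
  by rewrite integralB_EFin// integral_step_extension.
set k := (\int[mu2]_(z in B) (K z)%:E)%E in subE.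
have fk : k \is a fin_num by exact: integrable_fin_num.
have -> : (`|\sum_(i in P) \sum_(j in P')
       (G (grid i, grid j) - K (grid i, grid j)) / N%:R ^+ 2|%:E =
   `|\int[mu2]_(z in B) ((step_extension N G z)%:E - (K z)%:E)
     - \int[mu2]_(z in B) ((step_extension N K z)%:E - (K z)%:E)|)%E.
  rewrite !subE -(fineK fk) -!EFinB abse_EFin; congr (`|_|%:E)%E.
  rewrite opprB addrA subrK -sumrB; apply: eq_bigr => i _.
  by rewrite -sumrB; apply: eq_bigr => j _; rewrite mulrBl.
apply: le_trans (lee_abs_sub _ _) _; apply: leeD.
  apply: ereal_sup_ubound; exists (block P, block P') => //=.
  have sub Q : block Q `<=` (`[0, 1] : set R).
    move=> t /block_sub; rewrite /= !in_itv/= => /andP[-> /ltW ->] //.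
  by split; [exact: measurable_block|exact: sub|exact: measurable_block|exact: sub].
have mD H (D : set (R * R)) : measurable D -> D `<=` half_open_square R ->
    measurable_fun D (fun z => ((step_extension N H z)%:E - (K z)%:E)%E).
  move=> mD' DQ; apply: emeasurable_funB.
    apply: measurable_funS DQ (measurable_int _ (integrable_step_extension N H N0)).
    exact: measurable_half_open_square.
  apply: measurable_funS DQ (measurable_int _ (integrable_kernel _ hK)).
  exact: measurable_half_open_square.
apply: (le_trans (le_abse_integral mu2 mB (mD K B mB BQ))).
apply: ge0_subset_integral => //; first exact: measurable_half_open_square.
apply: measurableT_comp => //; apply: mD => //; exact: measurable_half_open_square.
Qed.

(** The factor 2 bounds [N / (N - 1)]; the remaining constant is that of
    [sum_norm_offdiag_le] with [d + 1] colours. *)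
Lemma mean_interaction_error_le (d N : nat) G K
    (f : 'I_d.+1 * 'I_d.+1 -> R) (M : R) (x : {ffun 'I_N -> 'I_d.+1}) :
  (1 < N)%N -> bounded_Borel K -> 0 <= M -> (forall ab, `|f ab| <= M) ->
  (cut_norm (step_extension N G \- K)%R + step_error K N)%E \is a fin_num ->
  N%:R^-1 * \sum_(i < N) `|finite_interaction G f x i
    - interaction K f (x i) (empirical_measure x i) (grid i)| <=
  2 * (M * fine (cut_norm (step_extension N G \- K)%R + step_error K N)%E
         *+ (2 * d.+1 + 4)).
Proof.
move=> N1 hK M0 fM fin; have N0 : (0 < N)%N by exact: ltnW.
set c := fine _.
pose w (i j : 'I_N) := (G (grid i, grid j) - K (grid i, grid j)) / N%:R ^+ 2.
have wc (P P' : {set 'I_N}) : `|\sum_(i in P) \sum_(j in P') w i j| <= c.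
  by rewrite -lee_fin /c fineK//; exact: grid_sum_le_cut_norm.
have N0' : 0 < N%:R :> R by rewrite ltr0n.
have N1' : 0 < N.-1%:R :> R by rewrite ltr0n -ltnS prednK.
have -> : N%:R^-1 * \sum_(i < N) `|finite_interaction G f x i
    - interaction K f (x i) (empirical_measure x i) (grid i)| =
    N%:R / N.-1%:R * \sum_i `|\sum_(j | j != i) w i j * f (x i, x j)|.
  rewrite !mulr_sumr; apply: eq_bigr => i _.
  rewrite interaction_empirical// /finite_interaction -mulrBr -sumrB.
  have -> : \sum_(j | j != i) (G (grid i, grid j) * f (x i, x j)
      - K (grid i, grid j) * f (x i, x j)) =
      N%:R ^+ 2 * \sum_(j | j != i) w i j * f (x i, x j).
    rewrite mulr_sumr; apply: eq_bigr => j _.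
    by rewrite /w -mulrBl; field; rewrite gt_eqF.
  rewrite [in LHS]mulrA normrM (@ger0_norm _ (N.-1%:R^-1 * N%:R ^+ 2)); last first.
    by rewrite mulr_ge0 ?exprn_ge0 ?invr_ge0 ?ltW.
  by field; rewrite !gt_eqF.
apply: ler_pM.
- exact: divr_ge0.
- exact: sumr_ge0.
- rewrite ler_pdivrMr// -natrM ler_nat.
  by case: (N) N1 => // -[//|n] _; rewrite mul2n -addnn /= addSn ltnS leq_addl.
have := sum_norm_offdiag_le _ _ _ _ wc _ x (fun a b => f (a, b)) M M0
  (fun a b => fM (a, b)).
by rewrite card_ord.
Qed.

End approximation.

Theorem proposition11 (R : realType) (d : nat)
    (K : R * R -> R) (f : 'I_d.+1 * 'I_d.+1 -> R) (KN : nat -> R * R -> R)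
    (hK : bounded_Borel K) (hKc : almost_uniformly_continuous K)
    (hKN : cut_norm (step_extension N (KN N) \- K) @[N --> \oo] --> 0%E) :
  sup [set N%:R^-1 * \sum_(i < N)
              `|finite_interaction (KN N) f x i
                - interaction K f (x i) (empirical_measure x i) (grid i)|
      | x in [set: {ffun 'I_N -> 'I_d.+1}]] @[N --> \oo] --> (0 : R).
Proof.
pose M : R := \sum_ab `|f ab|.
have M0 : 0 <= M by exact: sumr_ge0.
have fM ab : `|f ab| <= M by rewrite /M (bigD1 ab)//= lerDl sumr_ge0.
pose c N := (cut_norm (step_extension N (KN N) \- K)%R + step_error K N)%E.
have /fine_cvgP[c_fin c_cvg] : c N @[N --> \oo] --> (0 : R)%:E.
  rewrite -[X in _ --> X]adde0; apply: cvgeD => //; exact: step_error_cvg.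
pose bound N := 2 * (M * fine (c N) *+ (2 * d.+1 + 4)).
have bound_cvg : bound N @[N --> \oo] --> (0 : R).
  rewrite [X in _ --> X](_ : 0 = 2 * (M * 0 *+ (2 * d.+1 + 4))).
    exact: cvgM (cvg_cst _) (cvgMn (cvgM (cvg_cst _) c_cvg)).
  by rewrite mulr0 mul0rn mulr0.
apply: (@squeeze_cvgr _ _ _ _ (cst 0) bound) => //; last exact: cvg_cst.
near=> N.
set E := [set _ | x in _].
have ubE : ubound E (bound N).
  move=> _ [x _ <-]; apply: mean_interaction_error_le => //.
    by near: N; exact: nbhs_infty_gt.
  by near: N.
have [y Ey] : E !=set0 by eexists; exists [ffun=> ord0].
apply/andP; split; last by apply: ge_sup => //; exists y.
apply: le_trans (ub_le_sup _ Ey); last by exists (bound N).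
by case: Ey => x _ <-; rewrite mulr_ge0// sumr_ge0.
Unshelve. all: by end_near. Qed.
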